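(* For every real number $x$ with $0 < x < \pi/2$, the following two chains of inequalities hold: $$2 \frac{\sinh x}{x} + \frac{x}{\tan x} < 3 - \frac{x^4}{180} < 3 < 3 + \frac{31}{180}x^4 < 2 \frac{x}{\sinh x} + \frac{\tan x}{x}$$ and $$\frac{\sinh x}{x} + 2 \frac{x}{\tan x} < 3 - \frac{x^2}{2} < 3 < 3 + \frac{x^2}{2} < \frac{x}{\sinh x} + 2 \frac{\tan x}{x}.$$ *)

(* Defs.v *)
From Stdlib Require Export Reals.

(* Main.v *)
(** Every bound reduces to a polynomial inequality in [t = x^2], with
    [0 < t < 4], via the Taylor estimates [sin x >= x (1 - t/6 + t^2/120 - t^3/5040)],
    [cos x <= 1 - t/2 + t^2/24 - t^3/720 + t^4/40320] and
    [sinh x <= x (1 + t/6 + t^2/120 + t^3/4560)].  From these,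
    [x / tan x < 1 - t/3 - t^2/45 - t^3/2280],
    [tan x / x > 1 + t/3 + 2 t^2/15 + t^3/63] and
    [x / sinh x > 1 - t/6 + 7 t^2/360 - t^3/126]; in each combination the cubic
    remainders cancel or have the favourable sign. *)
Require Import Defs.
From Stdlib Require Import Reals.
From Stdlib Require Import Factorial Psatz.
Open Scope R_scope.

Lemma nonneg_of_deriv_nonneg (f f' : R -> R) (b x : R) :
  (forall c, derivable_pt_lim f c (f' c)) ->
  (forall c, 0 <= c < b -> 0 <= f' c) ->
  0 <= f 0 -> 0 <= x < b -> 0 <= f x.
Proof.
intros Hd Hpos H0 Hx.
destruct (Req_dec x 0) as [->|Hx0]; [exact H0|].
destruct (MVT_cor2 f f' 0 x) as [c [Hc Hcx]]; [lra|intros; apply Hd|].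
assert (0 <= f' c) by (apply Hpos; lra).
nra.
Qed.

(* [(f' + f) e^-x] has derivative [(f'' - f) e^-x], and [f e^x] has derivative
   [(f' + f) e^x]. *)
Lemma nonneg_of_second_deriv_ge (f f' f'' : R -> R) (b x : R) :
  (forall c, derivable_pt_lim f c (f' c)) ->
  (forall c, derivable_pt_lim f' c (f'' c)) ->
  (forall c, 0 <= c < b -> f c <= f'' c) ->
  0 <= f 0 -> 0 <= f' 0 -> 0 <= x < b -> 0 <= f x.
Proof.
intros Hf Hf' Hge Hf0 Hf'0 Hx.
assert (Hexpm : forall c, derivable_pt_lim (fun y => exp (- y)) c (- exp (- c))).
{ intros c.
  replace (- exp (- c)) with (exp (- c) * -1) by ring.
  apply (derivable_pt_lim_comp (fun y => - y) exp).
  - apply (derivable_pt_lim_opp id c 1), derivable_pt_lim_id.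
  - apply derivable_pt_lim_exp. }
assert (Hsum : forall c, 0 <= c < b -> 0 <= f' c + f c).
{ intros c Hc.
  assert (H : 0 <= (f' c + f c) * exp (- c)).
  { apply (nonneg_of_deriv_nonneg (fun y => (f' y + f y) * exp (- y))
      (fun y => (f'' y + f' y) * exp (- y) + (f' y + f y) * - exp (- y)) b);
      [| |rewrite Ropp_0, exp_0; lra|exact Hc].
    - intros y.
      apply (derivable_pt_lim_mult (fun z => f' z + f z) (fun z => exp (- z)));
        [|apply Hexpm].
      apply (derivable_pt_lim_plus f' f); auto.
    - intros y Hy.
      replace (_ + _) with ((f'' y - f y) * exp (- y)) by ring.
      apply Rmult_le_pos; [specialize (Hge y Hy); lra|apply Rlt_le, exp_pos]. }
  pose proof (exp_pos (- c)); nra. }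
assert (H : 0 <= f x * exp x).
{ apply (nonneg_of_deriv_nonneg (fun y => f y * exp y)
    (fun y => f' y * exp y + f y * exp y) b);
    [| |rewrite exp_0; lra|exact Hx].
  - intros y.
    apply (derivable_pt_lim_mult f exp); [apply Hf|apply derivable_pt_lim_exp].
  - intros y Hy.
    rewrite <- Rmult_plus_distr_r.
    apply Rmult_le_pos; [auto|apply Rlt_le, exp_pos]. }
pose proof (exp_pos x); nra.
Qed.

Lemma derivable_pt_lim_scal_pow (a : R) (n : nat) (c : R) :
  derivable_pt_lim (fun y => a * y ^ n) c (a * (INR n * c ^ pred n)).
Proof.
apply (derivable_pt_lim_scal (fun y => y ^ n)), derivable_pt_lim_pow.
Qed.

(* 4560 = 120 * 38: on [0, 2) the defect [f] then satisfies
   [f'' - f = (42/4560 - 1/120) x^5 - x^7/4560 = x^5 (4 - x^2)/4560 >= 0]. *)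
Lemma sinh_le_poly (x : R) : 0 <= x < 2 ->
  sinh x <= x * (1 + x ^ 2 / 6 + x ^ 4 / 120 + x ^ 6 / 4560).
Proof.
intros Hx.
(* Every monomial, even [1 * y ^ 1], has the shape [a * y ^ n], so that [derivable_pt_lim_scal_pow]
   differentiates the sum term by term. *)
pose (f := fun y => 1 * y ^ 1 + / 6 * y ^ 3 + / 120 * y ^ 5 + / 4560 * y ^ 7 - sinh y).
pose (f' := fun y => 1 * y ^ 0 + / 2 * y ^ 2 + / 24 * y ^ 4 + 7 / 4560 * y ^ 6 - cosh y).
pose (f'' := fun y => 1 * y ^ 1 + / 6 * y ^ 3 + 42 / 4560 * y ^ 5 - sinh y).
assert (H : 0 <= f x).
{ apply (nonneg_of_second_deriv_ge f f' f'' 2); [| | | | |exact Hx].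
  - intros c.
    replace (f' c) with (1 * (INR 1 * c ^ 0) + / 6 * (INR 3 * c ^ 2)
      + / 120 * (INR 5 * c ^ 4) + / 4560 * (INR 7 * c ^ 6) - cosh c)
      by (unfold f'; simpl; field).
    apply derivable_pt_lim_minus; [|apply derivable_pt_lim_sinh].
    repeat apply derivable_pt_lim_plus; apply derivable_pt_lim_scal_pow.
  - intros c.
    replace (f'' c) with (1 * (INR 0 * c ^ 0) + / 2 * (INR 2 * c ^ 1)
      + / 24 * (INR 4 * c ^ 3) + 7 / 4560 * (INR 6 * c ^ 5) - sinh c)
      by (unfold f''; simpl; field).
    apply derivable_pt_lim_minus; [|apply derivable_pt_lim_cosh].
    repeat apply derivable_pt_lim_plus; apply derivable_pt_lim_scal_pow.
  - intros c Hc.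
    enough (0 <= c ^ 5 * (4 - c ^ 2)) by (unfold f, f''; lra).
    apply Rmult_le_pos; [apply pow_le|]; nra.
  - unfold f; rewrite sinh_0; lra.
  - unfold f'; rewrite cosh_0; lra. }
unfold f in H; lra.
Qed.

(** Expands factorials as products of reals, so that 8! is never built as a unary numeral. *)
Lemma INR_fact_S (n : nat) : INR (fact (S n)) = (INR n + 1) * INR (fact n).
Proof. now rewrite fact_simpl, mult_INR, S_INR. Qed.

Lemma sin_ge_poly (x : R) : 0 <= x <= PI ->
  x * (1 - x ^ 2 / 6 + x ^ 4 / 120 - x ^ 6 / 5040) <= sin x.
Proof.
intros Hx.
(* The lower sum with parameter 1 runs over the indices 0 to 3, ending at [x ^ 7]. *)
destruct (sin_bound x 1) as [H _]; [lra|lra|].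
unfold sin_approx, sin_term in H; cbn [sum_f_R0 Nat.mul Nat.add] in H.
rewrite !INR_fact_S in H; cbn [fact INR] in H; simpl in H; lra.
Qed.

Lemma cos_le_poly (x : R) : - PI / 2 <= x <= PI / 2 ->
  cos x <= 1 - x ^ 2 / 2 + x ^ 4 / 24 - x ^ 6 / 720 + x ^ 8 / 40320.
Proof.
intros Hx.
(* The upper sum with parameter 1 runs over the indices 0 to 4, ending at [x ^ 8]. *)
destruct (cos_bound x 1) as [_ H]; [lra|lra|].
unfold cos_approx, cos_term in H; cbn [sum_f_R0 Nat.mul Nat.add] in H.
rewrite !INR_fact_S in H; cbn [fact INR] in H; simpl in H; lra.
Qed.

(* After cross-multiplying, in this lemma and the next, for the Taylor polynomials in
   [t = x^2] the resulting difference is [t^3] times a cubic or quartic that is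
   positive on [0, 4]. *)
Lemma div_tan_lt_poly (x : R) : 0 < x < PI / 2 ->
  x / tan x < 1 - x ^ 2 / 3 - x ^ 4 / 45 - x ^ 6 / 2280.
Proof.
intros Hx.
pose proof PI_4.
assert (Hs0 : 0 < sin x) by (apply sin_gt_0; lra).
assert (Hc0 : 0 < cos x) by (apply cos_gt_0; lra).
pose proof (sin_ge_poly x ltac:(lra)) as Hs.
pose proof (cos_le_poly x ltac:(lra)) as Hc.
assert (Ht : 0 < x ^ 2 < 4) by nra.
replace (x ^ 4) with ((x ^ 2) ^ 2) in * by ring.
replace (x ^ 6) with ((x ^ 2) ^ 3) in * by ring.
replace (x ^ 8) with ((x ^ 2) ^ 4) in * by ring.
set (t := x ^ 2) in *.
set (r := 1 - t / 3 - t ^ 2 / 45 - t ^ 3 / 2280).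
set (S := 1 - t / 6 + t ^ 2 / 120 - t ^ 3 / 5040) in *.
set (C := 1 - t / 2 + t ^ 2 / 24 - t ^ 3 / 720 + t ^ 4 / 40320) in *.
assert (HCS : C < r * S).
{ enough (0 < t ^ 3 * (241 / 143640 - 271 / 3830400 * t + 13 / 17236800 * t ^ 2
    + 1 / 11491200 * t ^ 3)) by (unfold C, r, S; lra).
  apply Rmult_lt_0_compat; [apply pow_lt; lra|].
  pose proof (pow_lt t 2 ltac:(lra)); pose proof (pow_lt t 3 ltac:(lra)); lra. }
assert (HS : 0 < S) by (unfold S; nra).
(* [r * S > C >= cos x > 0]. Then [x * cos x <= x * C < r * (x * S) <= r * sin x]. *)
assert (Hr : 0 < r) by nra.
apply (Rmult_lt_reg_r (sin x)); [lra|].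
replace (x / tan x * sin x) with (x * cos x) by (unfold tan; field; lra).
nra.
Qed.

Lemma tan_div_gt_poly (x : R) : 0 < x < PI / 2 ->
  1 + x ^ 2 / 3 + 2 * x ^ 4 / 15 + x ^ 6 / 63 < tan x / x.
Proof.
intros Hx.
pose proof PI_4.
assert (Hc0 : 0 < cos x) by (apply cos_gt_0; lra).
pose proof (sin_ge_poly x ltac:(lra)) as Hs.
pose proof (cos_le_poly x ltac:(lra)) as Hc.
assert (Ht : 0 < x ^ 2 < 4) by nra.
replace (x ^ 4) with ((x ^ 2) ^ 2) in * by ring.
replace (x ^ 6) with ((x ^ 2) ^ 3) in * by ring.
replace (x ^ 8) with ((x ^ 2) ^ 4) in * by ring.
set (t := x ^ 2) in *.
set (q := 1 + t / 3 + 2 * t ^ 2 / 15 + t ^ 3 / 63).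
set (S := 1 - t / 6 + t ^ 2 / 120 - t ^ 3 / 5040) in *.
set (C := 1 - t / 2 + t ^ 2 / 24 - t ^ 3 / 720 + t ^ 4 / 40320) in *.
assert (HCS : q * C < S).
{ enough (0 < t ^ 3 * (4 / 105 + 341 / 120960 * t - 293 / 604800 * t ^ 2
    + 17 / 907200 * t ^ 3 - 1 / 2540160 * t ^ 4)) by (unfold C, q, S; lra).
  apply Rmult_lt_0_compat; [apply pow_lt; lra|].
  (* The constant term absorbs the [t ^ 2] term, and the [t ^ 3] term absorbs the [t ^ 4] term. *)
  assert (t ^ 2 < 16) by nra.
  pose proof (pow_lt t 3 ltac:(lra)); assert (t ^ 4 < 4 * t ^ 3) by nra.
  lra. }
assert (Hq : 0 < q).
{ pose proof (pow_lt t 2 ltac:(lra)); pose proof (pow_lt t 3 ltac:(lra)).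
  unfold q; lra. }
apply (Rmult_lt_reg_r (x * cos x)); [nra|].
replace (tan x / x * (x * cos x)) with (sin x) by (unfold tan; field; lra).
assert (x * q * cos x <= x * q * C) by (apply Rmult_le_compat_l; nra).
assert (x * (q * C) < x * S) by (apply Rmult_lt_compat_l; lra).
lra.
Qed.

(** With [H] the upper bound for [sinh x / x], the product [p * H] is 1 plus terms in [t ^ 3] to
    [t ^ 6], all with negative coefficients. *)
Lemma div_sinh_gt_poly (x : R) : 0 < x < 2 ->
  1 - x ^ 2 / 6 + 7 * x ^ 4 / 360 - x ^ 6 / 126 < x / sinh x.
Proof.
intros Hx.
pose proof (sinh_le_poly x ltac:(lra)) as Hle.
assert (Hsinh : 0 < sinh x) by (rewrite <- sinh_0; apply sinh_lt; lra).
apply (Rmult_lt_reg_r (sinh x)); [exact Hsinh|].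
replace (x / sinh x * sinh x) with x by (field; lra).
assert (Ht : 0 < x ^ 2 < 4) by nra.
replace (x ^ 4) with ((x ^ 2) ^ 2) in * by ring.
replace (x ^ 6) with ((x ^ 2) ^ 3) in * by ring.
set (t := x ^ 2) in *.
set (p := 1 - t / 6 + 7 * t ^ 2 / 360 - t ^ 3 / 126).
set (H := 1 + t / 6 + t ^ 2 / 120 + t ^ 3 / 4560) in *.
assert (HpH : p * H < 1).
{ assert (0 < t ^ 3) by (apply pow_lt; lra).
  assert (0 < t ^ 4) by (apply pow_lt; lra).
  assert (0 < t ^ 5) by (apply pow_lt; lra).
  assert (0 < t ^ 6) by (apply pow_lt; lra).
  unfold p, H; lra. }
(* If [p <= 0], then [p * sinh x <= 0 < x]; otherwise [p * sinh x <= x * (p * H) < x]. *)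
destruct (Rle_or_lt p 0); nra.
Qed.

Theorem theorem3 : forall x : R, 0 < x < PI / 2 ->
  (2 * (sinh x / x) + x / tan x < 3 - x ^ 4 / 180 /\
   3 - x ^ 4 / 180 < 3 /\
   3 < 3 + 31 / 180 * x ^ 4 /\
   3 + 31 / 180 * x ^ 4 < 2 * (x / sinh x) + tan x / x)
  /\
  (sinh x / x + 2 * (x / tan x) < 3 - x ^ 2 / 2 /\
   3 - x ^ 2 / 2 < 3 /\
   3 < 3 + x ^ 2 / 2 /\
   3 + x ^ 2 / 2 < x / sinh x + 2 * (tan x / x)).
Proof.
intros x Hx.
pose proof PI_4.
pose proof (div_tan_lt_poly x Hx).
pose proof (tan_div_gt_poly x Hx).
pose proof (div_sinh_gt_poly x ltac:(lra)).
assert (sinh x / x <= 1 + x ^ 2 / 6 + x ^ 4 / 120 + x ^ 6 / 4560).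
{ apply (Rmult_le_reg_r x); [lra|].
  replace (sinh x / x * x) with (sinh x) by (field; lra).
  rewrite (Rmult_comm _ x); apply sinh_le_poly; lra. }
assert (0 < x ^ 2) by (apply pow_lt; lra).
assert (0 < x ^ 4) by (apply pow_lt; lra).
assert (0 < x ^ 6) by (apply pow_lt; lra).
(* The [x ^ 6] terms cancel in the first chain, as 2/4560 = 1/2280 and 2/126 = 1/63. In the second
   chain the [x ^ 4] and [x ^ 6] terms only strengthen the bounds. *)
repeat split; lra.
Qed.
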